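(* Let $A$ be an octonion division algebra over a field $F$ and let $\phi(z)=z^n+c_{n-1}z^{n-1}+\dots+c_1z+c_0$ be a monic standard polynomial over $A$, $n\ge 1$, with companion matrix $C_\phi$. Then $$LEV(C_\phi)=\bigcup_{\gamma\in A^\times}R(\phi_\gamma).$$
   Context: $F$ is a field of arbitrary characteristic. An octonion algebra over $F$ is an algebra $A=Q\oplus Q\ell$, where $Q$ is a quaternion algebra over $F$ with its canonical symplectic involution $\bar{\ }$, $\ell^2\in F^\times$, and multiplication is $(p+q\ell)(r+s\ell)=pr+\ell^2\bar{s}q+(sp+q\bar{r})\ell$. The involution extends to $A$ by $\overline{p+q\ell}=\overline{p}-q\ell$, and $\operatorname{Norm}(x)=\overline{x}\cdot x\in F$. $A$ is alternative; it is a division algebra if and only if its norm form is anisotropic. A standard polynomial over $A$ has its coefficients in $A$ on the left of the variable; for $\psi(z)=d_nz^n+\dots+d_0$ and $\lambda\in A$, $\psi(\lambda)=d_n\lambda^n+\dots+d_1\lambda+d_0$, and $R(\psi)=\{\lambda\in A:\psi(\lambda)=0\}$. For $\gamma\in A^\times$, the $\gamma$-twist of $\phi$ is $$\phi_\gamma(z)=\gamma^{-1}z^n+(\gamma^{-1}c_{n-1})z^{n-1}+\dots+(\gamma^{-1}c_1)z+\gamma^{-1}c_0.$$ The companion matrix $C_\phi$ is the $n\times n$ matrix over $A$ with $1$'s in positions $(i,i+1)$ for $1\le i\le n-1$, last row $(-c_0,-c_1,\dots,-c_{n-1})$, and zeros elsewhere. A left eigenvalue of $C_\phi$ is an element $\lambda\in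 A$ such that $C_\phi v=\lambda v$ for some nonzero column vector $v\in A^n$ (where $\lambda v$ is the entrywise left multiple by $\lambda$); $LEV(C_\phi)$ is the set of left eigenvalues. *)

(* Defs.v *)
From HB Require Import structures.
From mathcomp Require Export all_boot all_order all_algebra all_field.
From mathcomp Require Export classical_sets.

Set Implicit Arguments.
Unset Strict Implicit.
Unset Printing Implicit Defensive.

Import GRing.Theory.
Local Open Scope ring_scope.

(* A quaternion algebra is a central simple algebra of dimension 4; being
   unital, its two-sided ideals are exactly the subspaces I below. *)
Definition is_quaternion_algebra (F : fieldType) (Q : falgType F) : Prop :=
  [/\ \dim {:Q} = 4%N,
      'Z({:Q})%VS = 1%VS
    & forall I : {vspace Q}, ({:Q} * I <= I)%VS -> (I * {:Q} <= I)%VS ->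
        I = 0%VS \/ I = {:Q}%VS].

(* The canonical involution x |-> Trd(x) - x, i.e. the standard involution:
   x + bar x and x * bar x lie in F (and are then the reduced trace and norm).
   It is unique by canonical_involution_unique, in any characteristic. *)
Definition is_canonical_involution (F : fieldType) (Q : falgType F)
    (bar : {linear Q -> Q}) : Prop :=
  [/\ involutive bar,
      forall x y : Q, bar (x * y) = bar y * bar x,
      forall x : Q, x + bar x \in 1%VS
    & forall x : Q, x * bar x \in 1%VS].

Lemma canonical_involution_unique (F : fieldType) (Q : falgType F)
    (bar1 bar2 : {linear Q -> Q}) :
  is_canonical_involution bar1 -> is_canonical_involution bar2 ->
  bar1 =1 bar2.
Proof.
have bar1E (b : {linear Q -> Q}) : is_canonical_involution b -> b 1 = 1.
  case=> bK bM _ _; rewrite -[RHS]bK -[b 1 in RHS]mul1r bM bK.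
  by rewrite mul1r.
move=> B1 B2 x; have [] := boolP (x \in 1%VS).
  by move=> /vlineP[k ->]; rewrite !linearZ !bar1E.
move=> xNF; case: B1 B2 => _ _ T1 N1 [_ _ T2 N2].
have /vlineP[t tE] := T1 x; have /vlineP[t' t'E] := T2 x.
have /vlineP[m mE] := N1 x; have /vlineP[m' m'E] := N2 x.
have b1E : bar1 x = t *: 1 - x by rewrite -tE addrC addKr.
have b2E : bar2 x = t' *: 1 - x by rewrite -t'E addrC addKr.
have : (t - t') *: x = (m - m') *: 1.
  rewrite !scalerBl -mE -m'E b1E b2E !mulrBr -!scalerAr !mulr1.
  by rewrite opprB addrA subrK.
have [tt'|tNt'] := eqVneq t t'; first by rewrite b1E b2E tt'.
move=> /(congr1 ( *:%R (t - t')^-1)).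
rewrite scalerA mulVf ?subr_eq0 // scale1r => xE.
by case/negP: xNF; rewrite xE scalerA; apply/vlineP; eexists.
Qed.

(* The data (Q, qconj, l^2) from which A = Q (+) Q l is built. *)
Record octonionAlgebra (F : fieldType) := OctonionAlgebra {
  quat : falgType F;
  qconj : {linear quat -> quat};
  lsq : F;
  quatP : is_quaternion_algebra quat;
  qconjP : is_canonical_involution qconj;
  lsq_neq0 : lsq != 0 }.

(* The pair (p, q) stands for p + q l. Only the F-space structure is inherited
   from the product: the componentwise ring structure of quat A * quat A is
   irrelevant, the product of A being omul. *)
Definition oct (F : fieldType) (A : octonionAlgebra F) : Type :=
  (quat A * quat A)%type.

HB.instance Definition _ (F : fieldType) (A : octonionAlgebra F) :=
  GRing.Lmodule.on (oct A).

Section Octonions.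
Variables (F : fieldType) (A : octonionAlgebra F).

Definition oone : oct A := (1 : quat A, 0 : quat A).

Definition omul (x y : oct A) : oct A :=
  let: (p, q) := x in let: (r, s) := y in
  (p * r + lsq A *: (qconj A s * q), s * p + q * qconj A r).

(* The division property for a nonassociative algebra. *)
Definition is_division : Prop :=
  forall a b : oct A, a != 0 ->
    (exists! x : oct A, omul a x = b) /\ (exists! y : oct A, omul y a = b).

Definition ounits : set (oct A) :=
  [set x | exists y, omul x y = oone /\ omul y x = oone]%classic.

(* The inverse of x when x is a unit, and 0 otherwise. *)
Definition oinv (x : oct A) : oct A :=
  xget 0 [set y | omul x y = oone /\ omul y x = oone]%classic.

(* The bracketing x (x (... x)) is immaterial, A being alternative. *)
Definition opow (x : oct A) (k : nat) : oct A := iter k (omul x) oone.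

(* Standard polynomials are lists of coefficients, constant term first. *)
Definition oeval (d : seq (oct A)) (x : oct A) : oct A :=
  \sum_(i < size d) omul d`_i (opow x i).

Definition oroots (d : seq (oct A)) : set (oct A) :=
  [set x | oeval d x = 0]%classic.

(* z^n + c_(n-1) z^(n-1) + ... + c_0, where n = size c. *)
Definition monic_poly (c : seq (oct A)) : seq (oct A) := rcons c oone.

Definition twist (g : oct A) (d : seq (oct A)) : seq (oct A) :=
  [seq omul (oinv g) a | a <- d].

Definition companion n (c : n.-tuple (oct A)) : 'M[oct A]_n :=
  \matrix_(i, j) if i.+1 == n then - tnth c j
                 else if i.+1 == j then oone else 0.

Definition left_eigenvalues n (M : 'M[oct A]_n) : set (oct A) :=
  [set x | exists2 v : 'cV[oct A]_n, v != 0
         & forall i, \sum_j omul (M i j) (v j 0) = omul x (v i 0)]%classic.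

End Octonions.

Arguments ounits {F} A.

(* Main.v *)
Require Import Defs.

Set Implicit Arguments.
Unset Strict Implicit.
Unset Printing Implicit Defensive.

Import GRing.Theory.

Local Open Scope ring_scope.
Local Open Scope classical_set_scope.

(** The first n - 1 rows of [C v = x v] say that each entry of [v] is [x]
    times the previous one, so [v] is determined by its first entry [g], which
    is nonzero, and has entries [x (x (... (x g)))]. The last row then says
    that the sum of the [c_i (x (... (x g)))], with leading coefficient 1
    included, vanishes. As the octonions are alternative, [x (... (x g))]
    equals [x^i g] ([alt_powM]), and the middle Moufang identity
    [(g a) (b g) = (g (a b)) g], used with [a = g^-1 c_i] and [b = x^i], gives
    [c_i (x^i g) = (g ((g^-1 c_i) x^i)) g]. Summing over [i], the condition
    becomes [(g S) g = 0], where [S] is the value at [x] of the [g]-twist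
    ([oeval_twist]); in a division algebra this means [S = 0].

    The Moufang identities are derived from the two alternative laws in an
    arbitrary alternative ring. The alternative laws of the octonions follow
    from the identities [x' (x y) = N(x) y = (y x) x'], where [x'] is the
    conjugate of [x], because [x'] is a scalar minus [x]. *)

(** * Identities in alternative rings *)

Section AlternativeRings.
Variables (V : zmodType) (m : V -> V -> V).
Local Infix "**" := m (at level 40, left associativity).

(** [m] is biadditive and satisfies the left and the right alternative law; no
    unit is required. *)
Definition alternative : Prop :=
  [/\ left_distributive m +%R,
      right_distributive m +%R,
      forall x y, x ** (x ** y) = (x ** x) ** y
    & forall x y, (y ** x) ** x = y ** (x ** x)].

Hypothesis altV : alternative.

Lemma altl_linearized x y z :
  x ** (y ** z) + y ** (x ** z) = (x ** y) ** z + (y ** x) ** z.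
Proof.
case: altV => mDl mDr altl _.
have := altl (x + y) z; rewrite !(mDl, mDr) !altl -!addrA.
by move/addrI; rewrite !addrA; move/addIr.
Qed.

Lemma altr_linearized x y z :
  (z ** x) ** y + (z ** y) ** x = z ** (x ** y) + z ** (y ** x).
Proof.
case: altV => mDl mDr _ altr.
have := altr (x + y) z; rewrite !(mDl, mDr) !altr -!addrA.
by move/addrI; rewrite !addrA; move/addIr; rewrite addrC.
Qed.

Lemma alt_flexible x y : (x ** y) ** x = x ** (y ** x).
Proof.
case: altV => _ _ _ altr.
by have := altl_linearized x y x; rewrite altr => /addIr.
Qed.

(** Both sides are compared through linearized alternative laws, applied to
    the pairs (x a, x), (a, x y) and (y, a). *)
Lemma left_moufang x a y : ((x ** a) ** x) ** y = x ** (a ** (x ** y)).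
Proof.
case: altV => _ mDr altl _.
have E1 := altl_linearized (x ** a) x y.
have E2 := altr_linearized a (x ** y) x.
have E3 := altr_linearized y a (x ** x).
have E4 := congr1 (m x) (altr_linearized y a x).
rewrite !(mDr, altl) in E1 E2 E3 E4.
apply: (addIr (((x ** x) ** y) ** a + ((x ** x) ** a) ** y)).
by rewrite {2}E3 -E4 [RHS]addrA -E2 [RHS]addrAC E1 -[RHS]addrA
  [X in _ = _ + X]addrC.
Qed.

Lemma middle_moufang x y a : (x ** y) ** (a ** x) = (x ** (y ** a)) ** x.
Proof.
case: altV => _ mDr _ _.
have E1 := altr_linearized y (a ** x) x.
rewrite -alt_flexible left_moufang -mDr in E1.
have E2 := altr_linearized x y a.
have E3 := altl_linearized a y x.
(* Cyclic symmetry of the associator, [(a, x, y) = (y, a, x)]. *)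
have E : y ** (a ** x) + (a ** x) ** y = a ** (x ** y) + (y ** a) ** x.
  apply: (addIr ((a ** y) ** x)); rewrite -[LHS]addrA E2 addrCA.
  by rewrite [y ** _ + _]addrC E3 -addrA [_ ** x + _]addrC.
rewrite E mDr addrC in E1.
by rewrite alt_flexible (addrI _ E1).
Qed.

(** Left multiplication by a power of [x] is the corresponding iterate of left
    multiplication by [x], by the left Moufang identity in the form
    [x^(k+2) y = (x x^k x) y = x (x^k (x y))]. *)
Lemma alt_powM e (em : left_id e m) (me : right_id e m) x k y :
  iter k (m x) e ** y = iter k (m x) y.
Proof.
have powC j : x ** iter j (m x) e = iter j (m x) e ** x.
  by elim: j => [|j IH] /=; rewrite ?em ?me // alt_flexible -IH.
elim/ltn_ind: k y => -[|[|k]] IH y; rewrite //= ?me //.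
by rewrite (powC k) -alt_flexible left_moufang IH // -iterSr.
Qed.

(** The left inverse property: [u (g (u y)) = ((u g) u) y = u y], and [u] can
    be cancelled. *)
Lemma alt_mulKV e g u : left_id e m -> injective (m u) -> u ** g = e ->
  forall y, g ** (u ** y) = y.
Proof. by move=> em u_inj ug y; apply: u_inj; rewrite -left_moufang ug em. Qed.

End AlternativeRings.

(** * Alternativity of the octonions *)

Section OctonionTheory.
Variables (F : fieldType) (A : octonionAlgebra F).
Local Notation bar := (@qconj F A).
Local Notation mu := (lsq A).
Implicit Types (x y z g : oct A) (p q r s : quat A).

Lemma central_1vs p q : p \in 1%VS -> p * q = q * p.
Proof. by case/vlineP=> k ->; rewrite -scalerAl -scalerAr mul1r mulr1. Qed.

Lemma qtrC p q : (p + bar p) * q = q * (p + bar p).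
Proof. by apply: central_1vs; case: (qconjP A). Qed.

Lemma qconjC p : bar p * p = p * bar p.
Proof. by have := qtrC p p; rewrite mulrDl mulrDr => /addrI. Qed.

Lemma qconjK : involutive bar. Proof. by case: (qconjP A). Qed.

Lemma qconjM p q : bar (p * q) = bar q * bar p.
Proof. by case: (qconjP A). Qed.

Lemma qconj1 : bar 1 = 1.
Proof. by rewrite -[RHS]qconjK -[bar 1 in RHS]mul1r qconjM qconjK mul1r. Qed.

Lemma oct_eq x y : x.1 = y.1 -> x.2 = y.2 -> x = y.
Proof. by case: x y => [p q] [r s] /= -> ->. Qed.

Lemma omulDl : left_distributive (@omul F A) +%R.
Proof.
move=> [p q] [r s] [t u]; apply: oct_eq => /=.
  by rewrite mulrDl mulrDr scalerDr addrACA.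
by rewrite mulrDr mulrDl addrACA.
Qed.

Lemma omulDr : right_distributive (@omul F A) +%R.
Proof.
move=> [t u] [p q] [r s]; apply: oct_eq => /=.
  by rewrite raddfD /= mulrDl mulrDr scalerDr addrACA.
by rewrite raddfD /= mulrDr mulrDl addrACA.
Qed.

Lemma omulZl k x y : omul (k *: x) y = k *: omul x y.
Proof.
case: x y => [p q] [r s]; apply: oct_eq => /=.
  by rewrite scalerDr -!scalerAl -scalerAr !scalerA mulrC.
by rewrite scalerDr -scalerAl -scalerAr.
Qed.

Lemma omulZr k x y : omul x (k *: y) = k *: omul x y.
Proof.
case: x y => [p q] [r s]; apply: oct_eq => /=; rewrite linearZ /=.
  by rewrite scalerDr -!scalerAl -scalerAr !scalerA mulrC.
by rewrite scalerDr -scalerAl -scalerAr.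
Qed.

Lemma omul1x : left_id (oone A) (@omul F A).
Proof.
case=> r s; apply: oct_eq => /=.
  by rewrite mul1r mulr0 scaler0 addr0.
by rewrite mulr1 mul0r addr0.
Qed.

Lemma omulx1 : right_id (oone A) (@omul F A).
Proof.
case=> r s; apply: oct_eq => /=.
  by rewrite mulr1 raddf0 mul0r scaler0 addr0.
by rewrite mul0r qconj1 mulr1 add0r.
Qed.

Lemma omul0x x : omul 0 x = 0.
Proof. by apply: (addrI (omul 0 x)); rewrite -omulDl !addr0. Qed.

Lemma omulx0 x : omul x 0 = 0.
Proof. by apply: (addrI (omul x 0)); rewrite -omulDr !addr0. Qed.

Lemma omulxN x y : omul x (- y) = - omul x y.
Proof. by rewrite -scaleN1r omulZr scaleN1r. Qed.

Lemma omulNx x y : omul (- x) y = - omul x y.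
Proof. by rewrite -scaleN1r omulZl scaleN1r. Qed.

Lemma omul_suml I (r : seq I) (P : pred I) (f : I -> oct A) y :
  omul (\sum_(i <- r | P i) f i) y = \sum_(i <- r | P i) omul (f i) y.
Proof.
exact: (big_morph (fun x => omul x y) (fun u v => omulDl u v y)
  (omul0x y)).
Qed.

Lemma omul_sumr I (r : seq I) (P : pred I) (f : I -> oct A) y :
  omul y (\sum_(i <- r | P i) f i) = \sum_(i <- r | P i) omul y (f i).
Proof.
exact: (big_morph (omul y) (omulDr y) (omulx0 y)).
Qed.

(** The involution extended to the octonions: [p + q l] goes to
    [bar p - q l]. *)
Definition oconj x : oct A := (bar x.1, - x.2).

Lemma oconj_trace x : exists t, oconj x = t *: oone A - x.
Proof.
have [_ _ /(_ x.1)/vlineP[t tE] _] := qconjP A; exists t.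
by apply: oct_eq => /=; rewrite ?scaler0 ?sub0r // -tE addrC addKr.
Qed.

(** The scalar [k] is the norm of [x]. *)
Lemma oconj_norm x :
  exists k : F, forall y, omul (oconj x) (omul x y) = k *: y
                   /\ omul (omul y x) (oconj x) = k *: y.
Proof.
case: x => p q; have [_ _ _ N] := qconjP A.
have /vlineP[a aE] := N p; have /vlineP[b bE] := N q.
have aE' : bar p * p = a *: 1 by rewrite qconjC.
have bE' : bar q * q = b *: 1 by rewrite qconjC.
exists (a - mu * b) => -[r s]; split; apply: oct_eq => /=.
all: rewrite ?raddfN ?raddfD /= ?linearZ /= ?qconjM ?qconjK.
all: rewrite !(mulrDl, mulrDr, mulrN, mulNr, opprD).
all: rewrite -?(scalerAl, scalerAr) ?scalerBl ?scalerDr ?scalerN -?scalerA.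
- by rewrite -[r * _ * q]mulrA bE' !mulrA aE' addrA addrK
    -scalerAl -scalerAr mul1r mulr1.
- by rewrite !mulrA bE addrA addrK -mulrA aE
    -scalerAl -scalerAr mul1r mulr1.
- by rewrite !mulrA bE' [- _ - _]addrC addrA addrK -mulrA aE
    -scalerAl -scalerAr mul1r mulr1.
- by rewrite !mulrA bE addrACA addNr add0r addrC -mulrA aE'
    -scalerAl -scalerAr mul1r mulr1.
Qed.

(** Substituting [x' = t - x] in [x' (x y) = k y] gives
    [x (x y) = t (x y) - k y], and the same computation with [y = 1] gives
    [x x = t x - k]; the right alternative law is symmetric. *)
Lemma omul_alternative : alternative (@omul F A).
Proof.
split=> [||x y|x y]; [exact: omulDl | exact: omulDr | |].
all: have [t tE] := oconj_trace x; have [k kE] := oconj_norm x.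
- have sqM z : omul x (omul x z) = t *: omul x z - k *: z.
    have [<- _] := kE z; rewrite tE omulDl omulZl omul1x omulNx.
    by rewrite opprB addrC subrK.
  have := sqM (oone A); rewrite omulx1 => ->.
  by rewrite sqM omulDl omulNx !omulZl omul1x.
- have Msq z : omul (omul z x) x = t *: omul z x - k *: z.
    have [_ <-] := kE z; rewrite tE omulDr omulZr omulx1 omulxN.
    by rewrite opprB addrC subrK.
  have := Msq (oone A); rewrite omul1x => ->.
  by rewrite Msq omulDr omulxN !omulZr omulx1.
Qed.

Lemma opowM x k y : omul (opow x k) y = iter k (omul x) y.
Proof. exact: (alt_powM omul_alternative omul1x omulx1). Qed.

(** * Roots of twists *)

Section Division.
Hypothesis A_division : is_division A.

Lemma omul_injl g : g != 0 -> injective (omul g).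
Proof.
move=> g0 x y gxy; have [[z [_ zU]] _] := A_division (omul g y) g0.
by rewrite -(zU x gxy) -(zU y).
Qed.

Lemma omul_injr g : g != 0 -> injective (fun x => omul x g).
Proof.
move=> g0 x y gxy; have [_ [z [_ zU]]] := A_division (omul y g) g0.
by rewrite -(zU x gxy) -(zU y).
Qed.

Lemma oone_neq0 : oone A != 0.
Proof. by apply/eqP => -[/eqP]; rewrite oner_eq0. Qed.

Lemma ounitsE g : ounits A g <-> g != 0.
Proof.
split=> [[u [gu _]]|g0].
  by apply: contraNneq oone_neq0 => g0; rewrite -gu g0 omul0x.
have [[u [gu _]] _] := A_division (oone A) g0; exists u; split=> //.
(* The right inverse [u] is also a left one: [g (u g) = (g u) g = g]. *)
apply: (omul_injl g0).
by rewrite -(alt_flexible omul_alternative) gu omul1x omulx1.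
Qed.

Lemma omul_oinvK g a : g != 0 -> omul g (omul (oinv g) a) = a.
Proof.
move=> /ounitsE[u gu].
have [gi ig] : omul g (oinv g) = oone A /\ omul (oinv g) g = oone A.
  exact: (xgetI 0 (gu : [set y | omul g y = oone A /\ omul y g = oone A] u)).
apply: (alt_mulKV omul_alternative omul1x _ ig); apply: omul_injl.
by apply: contraNneq oone_neq0 => i0; rewrite -gi i0 omulx0.
Qed.

(** The termwise identity [c (x^i g) = (g ((g^-1 c) x^i)) g] is the middle
    Moufang identity. *)
Lemma oeval_twist g (d : seq (oct A)) x : g != 0 ->
  \sum_(i < size d) omul d`_i (iter i (omul x) g)
    = omul (omul g (oeval (twist g d) x)) g.
Proof.
move=> g0; rewrite /oeval size_map omul_sumr omul_suml.
apply: eq_bigr => i _; rewrite (nth_map 0) // -opowM.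
rewrite -{1}[d`_i](omul_oinvK _ g0).
exact: (middle_moufang omul_alternative).
Qed.

Lemma oroots_twist g (d : seq (oct A)) x : g != 0 ->
  oroots (twist g d) x <-> \sum_(i < size d) omul d`_i (iter i (omul x) g) = 0.
Proof.
move=> g0; rewrite (oeval_twist _ _ g0); split=> [->|gSg0].
  by rewrite omulx0 omul0x.
apply: (omul_injl g0); apply: (omul_injr g0).
by rewrite gSg0 omulx0 omul0x.
Qed.

End Division.

(** * Eigenvectors of the companion matrix *)

Lemma sum_monic_poly n (c : n.-tuple (oct A)) (w : nat -> oct A) :
  \sum_(i < size (monic_poly c)) omul (monic_poly c)`_i (w i)
    = \sum_(i < n) omul (tnth c i) (w i) + w n.
Proof.
rewrite size_rcons size_tuple big_ord_recr /= nth_rcons size_tuple ltnn eqxx.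
rewrite omul1x; congr (_ + _); apply: eq_bigr => i _.
by rewrite nth_rcons size_tuple ltn_ord -tnth_nth.
Qed.

Lemma companion_row n (c : n.+1.-tuple (oct A)) (v : 'cV[oct A]_n.+1) i :
  \sum_j omul (companion c i j) (v j 0)
    = if i.+1 == n.+1 then - \sum_j omul (tnth c j) (v j 0)
      else v (inord i.+1) 0.
Proof.
case: ifP => [in1|in1].
  rewrite -sumrN; apply: eq_bigr => j _.
  by rewrite mxE in1 omulNx.
have lt_i : (i.+1 < n.+1)%N by rewrite ltn_neqAle in1 ltn_ord.
rewrite (bigD1 (inord i.+1)) //= mxE in1 inordK // eqxx omul1x.
rewrite big1 ?addr0 // => j ji; rewrite mxE in1.
case: eqP => [ij|_]; last by rewrite omul0x.
by rewrite ij inord_val eqxx in ji.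
Qed.

(** The element [g] is the first entry of an eigenvector. *)
Lemma left_eigenvalues_companion n (c : n.+1.-tuple (oct A)) x :
  left_eigenvalues (companion c) x <->
  exists2 g, g != 0
    & \sum_(i < size (monic_poly c))
        omul (monic_poly c)`_i (iter i (omul x) g) = 0.
Proof.
split=> [[v v0 vE]|[g g0]].
- have vi (i : 'I_n.+1) : v i 0 = iter i (omul x) (v 0 0).
    case: i => i; elim: i => [|i IH] lt_i.
      by congr (v _ 0); apply: val_inj.
    rewrite iterS -(IH (ltnW lt_i)) -vE companion_row /= ltn_eqF //.
    by congr (v _ 0); apply: val_inj; rewrite /= inordK.
  exists (v 0 0).
    apply: contraNneq v0 => v00; apply/eqP/matrixP=> i j.
    rewrite (ord1 j) vi v00 mxE.
    by elim: (val i) => //= k ->; rewrite omulx0.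
  rewrite (sum_monic_poly c (fun i => iter i (omul x) (v 0 0))) /=.
  have := vE ord_max; rewrite companion_row eqxx vi /= => <-.
  by apply/eqP; rewrite subr_eq0; apply/eqP; apply: eq_bigr => i _; rewrite -vi.
- rewrite (sum_monic_poly c (fun i => iter i (omul x) g)) => cg.
  exists (\col_i iter i (omul x) g).
    by apply: contraNneq g0 => /matrixP/(_ 0 0); rewrite !mxE => /= ->.
  move=> i; rewrite companion_row !mxE -iterS; case: eqP => [->|/eqP in1].
    move/eqP: cg; rewrite addrC addr_eq0 => /eqP ->.
    by congr (- _); apply: eq_bigr => j _; rewrite mxE.
  by rewrite inordK // ltn_neqAle in1 ltn_ord.
Qed.

End OctonionTheory.

Theorem theorem4p1 (F : fieldType) (A : octonionAlgebra F)
    (A_division : is_division A) (n : nat) (n_gt0 : (1 <= n)%N)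
    (c : n.-tuple (oct A)) :
  left_eigenvalues (companion c) =
    \bigcup_(g in ounits A) oroots (twist g (monic_poly c)).
Proof.
case: n n_gt0 c => // n _ c; apply/seteqP; split=> x.
- case/left_eigenvalues_companion=> g g0 Eg.
  by exists g; [apply/ounitsE | apply/oroots_twist].
- case=> g /(ounitsE A_division) g0 /(oroots_twist A_division _ _ g0) Eg.
  by apply/left_eigenvalues_companion; exists g.
Qed.
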